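(* Let $n>1$ and let $(x_j)_{j\ge1}$ be a sequence with values in $\{a_1,a_2,\dots,a_n\}\subseteq K_n$. Assume that for every $i\in\{1,\dots,n\}$ there are infinitely many $k\ge 1$ with $x_k=a_i$. Let $s_j=x_1x_2\cdots x_j$ for $j\ge1$. Then there exists $m_0\in\mathbb{N}$ such that $s_m=f$ for all $m\ge m_0$.
   Context: Kiselman's semigroup $K_n$ is the monoid, with unit element $e$, given by generators $a_1,\dots,a_n$ and relations $a_i^2=a_i$ for all $1\le i\le n$, and $a_i a_j a_i = a_j a_i a_j = a_i a_j$ for all $1\le j<i\le n$. The element $f=a_na_{n-1}\cdots a_1$ is the zero element of $K_n$, i.e. $fx=xf=f$ for all $x\in K_n$. *)

(* Defs.v *)
From HB Require Import structures.
From mathcomp Require Import all_boot.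
From mathcomp Require Import boolp classical_sets functions cardinality.

Set Implicit Arguments.
Unset Strict Implicit.
Unset Printing Implicit Defensive.

Local Open Scope group_scope.
Local Open Scope quotient_scope.

(* The free monoid on a_1, ..., a_n is [seq 'I_n]: the ordinal [i] (with value
   in 0, ..., n-1) stands for the letter a_(i+1). *)
Inductive kiselman_rel (n : nat) : seq 'I_n -> seq 'I_n -> Prop :=
| kiselman_rel_idem (i : 'I_n) : kiselman_rel [:: i; i] [:: i]
| kiselman_rel_iji (i j : 'I_n) : (j < i)%N ->
    kiselman_rel [:: i; j; i] [:: i; j]
| kiselman_rel_jij (i j : 'I_n) : (j < i)%N ->
    kiselman_rel [:: j; i; j] [:: i; j].

(* The monoid congruence generated by the defining relations. *)
Inductive kiselman_cong (n : nat) : seq 'I_n -> seq 'I_n -> Prop :=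
| kiselman_cong_step (p q u v : seq 'I_n) : kiselman_rel u v ->
    kiselman_cong (p ++ u ++ q) (p ++ v ++ q)
| kiselman_cong_refl (u : seq 'I_n) : kiselman_cong u u
| kiselman_cong_sym (u v : seq 'I_n) :
    kiselman_cong u v -> kiselman_cong v u
| kiselman_cong_trans (u v w : seq 'I_n) :
    kiselman_cong u v -> kiselman_cong v w -> kiselman_cong u w.

Lemma kiselman_cong_ctx (n : nat) (p q u v : seq 'I_n) :
  kiselman_cong u v -> kiselman_cong (p ++ u ++ q) (p ++ v ++ q).
Proof.
elim=> {u v} [p' q' u v uv|u|u v _|u v w _ uv _]; last 3 first.
- exact: kiselman_cong_refl.
- exact: kiselman_cong_sym.
- exact: kiselman_cong_trans.
have := kiselman_cong_step (p ++ p') (q' ++ q) uv.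
by rewrite -!catA.
Qed.

Lemma kiselman_cong_cat (n : nat) (u u' v v' : seq 'I_n) :
  kiselman_cong u u' -> kiselman_cong v v' ->
  kiselman_cong (u ++ v) (u' ++ v').
Proof.
move=> uu' vv'; apply: (@kiselman_cong_trans _ _ (u' ++ v)).
  exact: (kiselman_cong_ctx [::] v uu').
by have := kiselman_cong_ctx u' [::] vv'; rewrite !cats0.
Qed.

Definition kiselman_congb (n : nat) : rel (seq 'I_n) :=
  fun u v => `[< kiselman_cong u v >].

Lemma kiselman_congb_refl (n : nat) : reflexive (@kiselman_congb n).
Proof. by move=> u; apply/asboolP; exact: kiselman_cong_refl. Qed.

Lemma kiselman_congb_sym (n : nat) : symmetric (@kiselman_congb n).
Proof.
by move=> u v; apply/asboolP/asboolP; exact: kiselman_cong_sym.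
Qed.

Lemma kiselman_congb_trans (n : nat) : transitive (@kiselman_congb n).
Proof.
move=> v u w /asboolP uv /asboolP vw; apply/asboolP.
exact: kiselman_cong_trans uv vw.
Qed.

Canonical kiselman_equiv (n : nat) := EquivRel (@kiselman_congb n)
  (@kiselman_congb_refl n) (@kiselman_congb_sym n) (@kiselman_congb_trans n).

Definition kiselman (n : nat) : Type := {eq_quot kiselman_equiv n}.

HB.instance Definition _ (n : nat) := Choice.on (kiselman n).
HB.instance Definition _ (n : nat) := EqQuotient.on (kiselman n).

Definition kiselman_pi (n : nat) (u : seq 'I_n) : kiselman n :=
  \pi_(kiselman n) u.

Lemma kiselman_piP (n : nat) (u v : seq 'I_n) :
  kiselman_pi u = kiselman_pi v <-> kiselman_cong u v.
Proof.
split=> [/eqmodP/asboolP //|uv].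
by apply/eqmodP/asboolP.
Qed.

Lemma kiselman_reprK (n : nat) (x : kiselman n) : kiselman_pi (repr x) = x.
Proof. exact: reprK. Qed.

Definition kiselman_one (n : nat) : kiselman n := kiselman_pi [::].

Definition kiselman_mul (n : nat) (x y : kiselman n) : kiselman n :=
  kiselman_pi (repr x ++ repr y).

Lemma kiselman_mul_pi (n : nat) (u v : seq 'I_n) :
  kiselman_mul (kiselman_pi u) (kiselman_pi v) = kiselman_pi (u ++ v).
Proof.
by apply/kiselman_piP; apply: kiselman_cong_cat;
  apply/kiselman_piP; rewrite kiselman_reprK.
Qed.

Lemma kiselman_mulA (n : nat) : associative (@kiselman_mul n).
Proof.
move=> x y z.
rewrite -(kiselman_reprK x) -(kiselman_reprK y) -(kiselman_reprK z).
by rewrite !kiselman_mul_pi catA.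
Qed.

Lemma kiselman_mul1 (n : nat) : left_id (kiselman_one n) (@kiselman_mul n).
Proof. by move=> x; rewrite -(kiselman_reprK x) kiselman_mul_pi. Qed.

Lemma kiselman_mulr1 (n : nat) : right_id (kiselman_one n) (@kiselman_mul n).
Proof. by move=> x; rewrite -(kiselman_reprK x) kiselman_mul_pi cats0. Qed.

HB.instance Definition _ (n : nat) := isMonoid.Build (kiselman n)
  (@kiselman_mulA n) (@kiselman_mul1 n) (@kiselman_mulr1 n).

(* [kgen i] is a_(i+1). *)
Definition kgen (n : nat) (i : 'I_n) : kiselman n := kiselman_pi [:: i].

(* f = a_n a_(n-1) ... a_1: as [i] runs over 0, ..., n-1, the letter
   [rev_ord i] is a_(n-i). *)
Definition kzero (n : nat) : kiselman n := \prod_(i < n) kgen (rev_ord i).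

Lemma kiselman_pi_prod (n : nat) (u : seq 'I_n) :
  kiselman_pi u = \prod_(i <- u) kgen i.
Proof.
elim: u => [|i u IHu]; first by rewrite big_nil.
by rewrite big_cons -IHu; symmetry; exact: kiselman_mul_pi.
Qed.

Lemma kgen_idem (n : nat) (i : 'I_n) : kgen i * kgen i = kgen i.
Proof.
rewrite [LHS]kiselman_mul_pi; apply/kiselman_piP.
exact: (kiselman_cong_step [::] [::] (kiselman_rel_idem i)).
Qed.

Lemma kgen_iji (n : nat) (i j : 'I_n) : (j < i)%N ->
  kgen i * kgen j * kgen i = kgen i * kgen j.
Proof.
move=> ltji; rewrite /kgen [in RHS]/mul /= [in LHS]/mul /= !kiselman_mul_pi.
apply/kiselman_piP.
exact: (kiselman_cong_step [::] [::] (kiselman_rel_iji ltji)).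
Qed.

Lemma kgen_jij (n : nat) (i j : 'I_n) : (j < i)%N ->
  kgen j * kgen i * kgen j = kgen i * kgen j.
Proof.
move=> ltji; rewrite /kgen [in RHS]/mul /= [in LHS]/mul /= !kiselman_mul_pi.
apply/kiselman_piP.
exact: (kiselman_cong_step [::] [::] (kiselman_rel_jij ltji)).
Qed.

(* Main.v *)
Require Import Defs.
From mathcomp Require Import all_boot.
From mathcomp Require Import boolp classical_sets functions cardinality.

(**
A letter absorbs its later copies across letters that are not larger, and its
earlier copies across letters that are not smaller.  Hence, if a word contains
a_n a_(n-1) ... a_1 as a (not necessarily contiguous) subword, then all a_n
after the first one can be erased, what follows the first a_n reduces
inductively to a_(n-1) ... a_1, and the letters before it are absorbed.  So the
word equals f.  Since every letter recurs, some prefix of the sequence, and then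
every longer one, contains this subword.
*)

Local Open Scope classical_set_scope.
Local Open Scope group_scope.

(** Induction on [w]: as [j <= i], a copy of [kgen i] can be inserted after the first letter [j],
    and the induction hypothesis then acts on the rest. *)
Lemma kgen_absorb_right (n : nat) (i : 'I_n) (w : seq 'I_n) :
  all (fun j : 'I_n => (j <= i)%N) w ->
  kgen i * kiselman_pi w * kgen i = kgen i * kiselman_pi w.
Proof.
rewrite kiselman_pi_prod; elim: w => [_|j w IHw /= /andP[le_ji /IHw wi]].
  by rewrite big_nil !mulg1 kgen_idem.
have ji : kgen i * kgen j * kgen i = kgen i * kgen j.
  case: (ltngtP j i) le_ji => // [/kgen_iji //|/val_inj -> _].
  by rewrite !kgen_idem.
by rewrite big_cons !mulgA -ji -!mulgA (mulgA (kgen i) _ (kgen i)) wi.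
Qed.

Lemma kgen_absorb_left (n : nat) (i : 'I_n) (w : seq 'I_n) :
  all (fun j : 'I_n => (i <= j)%N) w ->
  kgen i * kiselman_pi w * kgen i = kiselman_pi w * kgen i.
Proof.
rewrite kiselman_pi_prod; elim: w => [_|j w IHw /= /andP[le_ij /IHw wi]].
  by rewrite big_nil mul1g !mulg1 kgen_idem.
have ij : kgen i * kgen j * kgen i = kgen j * kgen i.
  case: (ltngtP i j) le_ij => // [/kgen_jij //|/val_inj -> _].
  by rewrite !kgen_idem.
by rewrite big_cons -!mulgA -wi !mulgA ij.
Qed.

(** Induction from the right end: a final [i] is absorbed by the leading one, any other last letter
    is kept. *)
Lemma kgen_mul_filter (n : nat) (i : 'I_n) (w : seq 'I_n) :
  all (fun j : 'I_n => (j <= i)%N) w ->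
  kgen i * kiselman_pi w = kgen i * kiselman_pi (filter (predC1 i) w).
Proof.
rewrite !kiselman_pi_prod; elim/last_ind: w => // w j IHw.
rewrite all_rcons => /andP[_ le_w]; rewrite filter_rcons /=.
case: eqVneq => [->|_] /=; rewrite !big_rcons /= !mulgA -IHw //.
by rewrite -kiselman_pi_prod kgen_absorb_right.
Qed.

(** In [s] only larger letters precede [j], so that occurrence absorbs the copy put in front. *)
Lemma kgen_mul_decreasing (n : nat) (s : seq 'I_n) (j : 'I_n) :
  sorted (fun i k : 'I_n => (k < i)%N) s -> j \in s ->
  kgen j * kiselman_pi s = kiselman_pi s.
Proof.
have tr : transitive (fun i k : 'I_n => (k < i)%N).
  by move=> b a c ba cb; exact: ltn_trans cb ba.
move=> + js; case/splitPr: js => p q; rewrite (sorted_pairwise tr).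
rewrite pairwise_cat => /andP[/allrelP pq _].
rewrite kiselman_pi_prod big_cat big_cons /= !mulgA -kiselman_pi_prod.
rewrite kgen_absorb_left //; apply/allP => k kp.
by apply/ltnW/pq => //; rewrite mem_head.
Qed.

(** Allowing any decreasing [s], not only the word of [f], lets the induction remove the head, which
    is the largest letter. *)
Lemma kiselman_pi_subseq_decreasing (n : nat) (s u : seq 'I_n) :
  sorted (fun i k : 'I_n => (k < i)%N) s -> {subset u <= s} -> subseq s u ->
  kiselman_pi u = kiselman_pi s.
Proof.
have tr : transitive (fun i k : 'I_n => (k < i)%N).
  by move=> b a c ba cb; exact: ltn_trans cb ba.
elim: s u => [|i s IHs] u sorted_s us su.
  by case: u us {su} => // j u /(_ j (mem_head _ _)).
have iu : i \in u by apply: (mem_subseq su); rewrite mem_head.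
have lt_s : all (fun k : 'I_n => (k < i)%N) s := order_path_min tr sorted_s.
have i_s : i \notin s by apply/negP => /(allP lt_s); rewrite ltnn.
(* The head [i] can be matched with its first occurrence in [u]; then [s] embeds after it and, not
   containing [i], survives the filter. *)
have ss : subseq s (filter (predC1 i) (drop (index i u).+1 u)).
  rewrite subseq_filter; apply/andP; split.
    by apply/allP => k ks /=; apply: contraNneq i_s => <-.
  elim: u iu su {us} => // k u IHu.
  rewrite inE /= eq_sym; case: eqVneq => _ /=; first by rewrite drop0.
  exact: IHu.
have : u = take (index i u) u ++ i :: drop (index i u).+1 u.
  by rewrite -{2}(nth_index i iu) -drop_nth ?index_mem // cat_take_drop.
move: (take _ _) (drop _ _) ss => v w ss def_u.
have ws k : k \in w -> k \in i :: s.
  by move=> kw; apply: us; rewrite def_u mem_cat inE kw !orbT.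
have le_w : all (fun k : 'I_n => (k <= i)%N) w.
  by apply/allP => k /ws; rewrite inE => /predU1P[->|/(allP lt_s)/ltnW].
have piw : kiselman_pi (i :: w) = kiselman_pi (i :: s).
  rewrite !(kiselman_pi_prod (_ :: _)) !big_cons -!kiselman_pi_prod.
  rewrite kgen_mul_filter //; congr (_ * _).
  apply: IHs => //; first exact: path_sorted sorted_s.
  by move=> k; rewrite mem_filter => /andP[/= ki /ws]; rewrite inE (negPf ki).
have vs k : k \in v -> k \in i :: s.
  by move=> kv; apply: us; rewrite def_u mem_cat kv.
rewrite def_u kiselman_pi_prod big_cat /= -!kiselman_pi_prod piw.
(* The letters of [v] are absorbed one at a time, the last one first. *)
elim: v vs {def_u} => [_|k v IHv vs]; first exact: mul1g.
rewrite (kiselman_pi_prod (k :: v)) big_cons -kiselman_pi_prod -mulgA IHv.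
  by rewrite kgen_mul_decreasing // vs ?mem_head.
by move=> l lv; apply: vs; rewrite inE lv orbT.
Qed.

Lemma infinite_set_nat_ge (A : set nat) (N : nat) :
  infinite_set A -> exists2 k, A k & (N <= k)%N.
Proof.
move=> infA; apply: contrapT => noA; apply: infA.
apply: (sub_finite_set _ (finite_II N)) => k Ak /=.
by rewrite ltnNge; apply/negP => Nk; apply: noA; exists k.
Qed.

(** Induction on [s] from the right: once [s] is a subword, the next occurrence of [i] extends it to
    [rcons s i]. *)
Lemma prefix_prod_subseq (n : nat) (x : nat -> kiselman n) (s : seq 'I_n) :
  (forall i : 'I_n,
    infinite_set [set k : nat | (1 <= k)%N /\ x k = kgen i]) ->
  exists N : nat, forall m : nat, (N <= m)%N ->
    exists2 u, \prod_(1 <= k < m.+1) x k = kiselman_pi u & subseq s u.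
Proof.
move=> hinf; elim/last_ind: s => [|s i [N sN]].
  exists 0 => m _; exists (repr (\prod_(1 <= k < m.+1) x k)).
    by rewrite kiselman_reprK.
  exact: sub0seq.
have [[//|k] [_ xk] Nk] := @infinite_set_nat_ge _ N.+1 (hinf i).
exists k.+1 => m km; have [u pu su] := sN k Nk.
(* The first [k] factors give [u] and factor [k.+1] gives [i]; any representative serves for the
   remaining factors. *)
exists (rcons u i ++ repr (\prod_(k.+2 <= l < m.+1) x l)).
  rewrite -kiselman_mul_pi kiselman_reprK (kiselman_pi_prod (rcons u i)).
  rewrite big_rcons /= -kiselman_pi_prod -pu -xk.
  rewrite -(big_nat_recr _ _ x) //=.
  by rewrite (@big_cat_nat _ _ _ k.+2).
apply: subseq_trans (prefix_subseq _ _).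
by rewrite -!cats1; exact: cat_subseq.
Qed.

Theorem corollary6p3 (n : nat) (hn : (1 < n)%N) (x : nat -> kiselman n)
  (hx : forall j : nat, (1 <= j)%N -> exists i : 'I_n, x j = kgen i)
  (hinf : forall i : 'I_n,
    infinite_set [set k : nat | (1 <= k)%N /\ x k = kgen i]) :
  exists m0 : nat, forall m : nat, (m0 <= m)%N ->
    \prod_(1 <= k < m.+1) x k = kzero n.
Proof.
pose s := map (@rev_ord n) (index_enum 'I_n).
have -> : kzero n = kiselman_pi s by rewrite kiselman_pi_prod big_map.
have [N sN] := @prefix_prod_subseq _ _ s hinf.
exists N => m /sN[u -> su]; apply: kiselman_pi_subseq_decreasing su.
  (* The ordinals are enumerated in increasing order, which [rev_ord] reverses. *)
  have : sorted ltn (map val (index_enum 'I_n)).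
    have -> : index_enum 'I_n = enum 'I_n by rewrite [LHS]unlock enumT.
    by rewrite val_enum_ord iota_ltn_sorted.
  rewrite /s !sorted_map; apply: sub_sorted => i j /= ij.
  by rewrite ltn_sub2l // (leq_ltn_trans ij).
move=> j _; rewrite -(rev_ordK j); apply: map_f; exact: mem_index_enum.
Qed.
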